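(* Let $f \colon \mathbb{R}^n \to \mathbb{R} \cup \{+\infty\}$ be a lower semi-continuous function and let $\Omega \subset \mathbb{R}^n$ be a closed set such that: (A1) $\mathrm{dom} f \cap \Omega$ is unbounded; (A2) $\partial^\infty f(\infty) \cap (-N_\Omega(\infty)) = \{0\}$; (A3) $f$ is bounded from below on $\Omega$, i.e., $\inf_{x \in \Omega} f(x)$ is finite. If $f$ does not attain its infimum on $\Omega$, then $$0 \in \partial f(\infty) + N_\Omega(\infty).$$
   Context: $\mathbb{R}^n$ carries the Euclidean norm and scalar product. $\mathrm{dom} f := \{x \mid f(x) < \infty\}$ and $\mathrm{epi} f := \{(x,r) \in \mathbb{R}^n \times \mathbb{R} \mid f(x) \le r\}$. Regular normal cone: for a set $C \subset \mathbb{R}^N$ and $z \in C$, $\widehat{N}_C(z)$ is the set of $\xi \in \mathbb{R}^N$ with $\langle \xi, z' - z\rangle \le o(\|z' - z\|)$ as $z' \to z$, $z' \in C$. Normal cone at infinity: for an unbounded closed set $\Omega \subset \mathbb{R}^n$, $N_\Omega(\infty)$ is the set of all $\xi \in \mathbb{R}^n$ for which there exist $x_k \in \Omega$ with $\|x_k\| \to \infty$ and $\xi_k \in \widehat{N}_\Omega(x_k)$ with $\xi_k \to \xi$. Subdifferentials at infinity: for $f \colon \mathbb{R}^n \to \mathbb{R} \cup \{+\infty\}$ with $\mathrm{dom} f$ unbounded, let $N_{\mathrm{epi} f}(\infty_I)$ (with $I = \{1,\dots,n\} \subset \{1,\dots,n+1\}$) be the set of all $\zeta \in \mathbb{R}^{n+1}$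 for which there exist $(x_k, r_k) \in \mathrm{epi} f$ with $\|x_k\| \to \infty$ and $\zeta_k \in \widehat{N}_{\mathrm{epi} f}(x_k, r_k)$ with $\zeta_k \to \zeta$. Then $\partial f(\infty) := \{u \in \mathbb{R}^n \mid (u,-1) \in N_{\mathrm{epi} f}(\infty_I)\}$ and $\partial^\infty f(\infty) := \{u \in \mathbb{R}^n \mid (u,0) \in N_{\mathrm{epi} f}(\infty_I)\}$. *)

(* Defs.v *)
From HB Require Import structures.
From mathcomp Require Import all_boot all_order all_algebra.
From mathcomp Require Import all_classical all_reals all_analysis.

Set Implicit Arguments.
Unset Strict Implicit.
Unset Printing Implicit Defensive.

Import Order.TTheory GRing.Theory Num.Theory.
Import numFieldNormedType.Exports.

Local Open Scope classical_set_scope.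
Local Open Scope ring_scope.

Definition dot (R : realType) (n : nat) (x y : 'rV[R]_n) : R :=
  \sum_(i < n) x 0 i * y 0 i.

(* The library norm on 'rV[R]_n is the maximum norm.  It induces the same
   topology, which is the one used below for limits, closedness and
   semicontinuity; metric quantities use the Euclidean norm. *)
Definition enorm (R : realType) (n : nat) (x : 'rV[R]_n) : R :=
  Num.sqrt (dot x x).

(* Only meaningful for [C z]; every use below supplies this membership. *)
Definition regular_normal_cone (R : realType) (N : nat)
    (C : set 'rV[R]_N) (z : 'rV[R]_N) : set 'rV[R]_N :=
  [set xi | forall eps : R, 0 < eps ->
    \forall z' \near within C (nbhs z),
      dot xi (z' - z) <= eps * enorm (z' - z)].

Definition normal_cone_infty (R : realType) (n : nat)
    (Omega : set 'rV[R]_n) : set 'rV[R]_n :=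
  [set xi | exists x_ xi_ : nat -> 'rV[R]_n,
    [/\ forall k, Omega (x_ k),
        enorm (x_ k) @[k --> \oo] --> +oo,
        forall k, regular_normal_cone Omega (x_ k) (xi_ k) &
        xi_ k @[k --> \oo] --> xi]].

Definition edom (R : realType) (n : nat) (f : 'rV[R]_n -> \bar R) :
    set 'rV[R]_n :=
  [set x | (f x < +oo)%E].

(* The pair (x, r) of R^n x R as an element of R^(n+1). *)
Definition rpair (R : realType) (n : nat) (x : 'rV[R]_n) (r : R) :
    'rV[R]_(n + 1) :=
  row_mx x (const_mx r).

Definition epi (R : realType) (n : nat) (f : 'rV[R]_n -> \bar R) :
    set 'rV[R]_(n + 1) :=
  [set rpair p.1 p.2 | p in [set p : 'rV[R]_n * R | (f p.1 <= p.2%:E)%E]].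

(* N_{epi f}(oo_I): only the R^n-component of the base points is required to
   go to infinity. *)
Definition epi_normal_cone_infty (R : realType) (n : nat)
    (f : 'rV[R]_n -> \bar R) : set 'rV[R]_(n + 1) :=
  [set zeta | exists (x_ : nat -> 'rV[R]_n) (r_ : nat -> R)
                     (zeta_ : nat -> 'rV[R]_(n + 1)),
    [/\ forall k, epi f (rpair (x_ k) (r_ k)),
        enorm (x_ k) @[k --> \oo] --> +oo,
        forall k, regular_normal_cone (epi f) (rpair (x_ k) (r_ k)) (zeta_ k) &
        zeta_ k @[k --> \oo] --> zeta]].

Definition subdiff_infty (R : realType) (n : nat) (f : 'rV[R]_n -> \bar R) :
    set 'rV[R]_n :=
  [set u | epi_normal_cone_infty f (rpair u (- 1))].

Definition singular_subdiff_infty (R : realType) (n : nat)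
    (f : 'rV[R]_n -> \bar R) : set 'rV[R]_n :=
  [set u | epi_normal_cone_infty f (rpair u 0)].

(* Main.v *)
(** If the infimum is not attained, near-minimizers escape to infinity.  Given a
   near-minimizer [x0], let [xh] minimize [f x + |x - x0|^2] over the points of
   [Omega] near [x0].  Minimizing instead the decoupled function
   [f y + c |y - z|^2 + |z - x0|^2 + |z - xh|^2] over a small ball in [y] and a
   small ball of [Omega] in [z], for [c] large the minimizer [(y, z)] is interior,
   so that [u := -2 c (y - z)] is a regular subgradient of [f] at [y], and
   [-u + o(1)] is a regular normal to [Omega] at [z].  Scaling [(u, -1)] by
   [1 / (1 + |u|)] and passing to a cluster point gives [(w, s)] with
   [|w| - s = 1], [(w, s)] normal to [epi f] and [-w] normal to [Omega] at
   infinity.  The qualification condition excludes [s = 0], and dividing by [-s]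
   concludes. *)
Require Import Defs.
From HB Require Import structures.
From mathcomp Require Import all_boot all_order all_algebra.
From mathcomp Require Import all_classical all_reals all_analysis.
From mathcomp Require Import ring lra.

Set Implicit Arguments.
Unset Strict Implicit.
Unset Printing Implicit Defensive.

Import Order.TTheory GRing.Theory Num.Theory.
Import numFieldNormedType.Exports.

Local Open Scope classical_set_scope.
Local Open Scope ring_scope.

(** * Compactness and lower semicontinuity *)

(** The traces of the sets [B i] on [K] form, by directedness, a base of a proper filter. A cluster
    point of it in [K] belongs to each [B i] by closedness. *)
Lemma compact_bigcap_directed (T : topologicalType) (I : Type) (K : set T)
    (D : set I) (B : I -> set T) :
  compact K -> D !=set0 -> (forall i, D i -> closed (B i)) ->
  (forall i, D i -> K `&` B i !=set0) ->
  (forall i j, D i -> D j -> exists2 k, D k & B k `<=` B i `&` B j) ->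
  exists2 x, K x & forall i, D i -> B i x.
Proof.
move=> cK D0 cB KB0 dirB.
have FF : ProperFilter (filter_from D (fun i => K `&` B i)).
  apply: filter_from_proper => //.
  apply: filter_from_filter => // i j Di Dj.
  have [k Dk kij] := dirB _ _ Di Dj; exists k => // x [Kx /kij [Bi Bj]].
  by split; split.
have [|x [Kx clx]] := cK _ FF; first by case: D0 => i Di; exists i => // x [].
exists x => // i Di; apply: (cB i Di) => V Vx.
have [||y [[_ By] Vy]] := clx (K `&` B i) V => //; first by exists i.
by exists y.
Qed.

Lemma lsc_closed_sublevel (T : topologicalType) (R : realType)
    (F : T -> \bar R) (c : \bar R) :
  lower_semicontinuous F -> closed [set x | (F x <= c)%E].
Proof.
move=> lF x clx; rewrite /= leNgt; apply/negP => cF.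
(* Lower semicontinuity is tested at real levels only, so a real level is inserted between [c] and
   [F x]. *)
have [a ca aF] : exists2 a : R, (c <= a%:E)%E & (a%:E < F x)%E.
  move: c cF {clx} => [c| |] cF; last 2 first.
  - by case: (F x) cF.
  - case: (F x) cF => [r| |] // _; last by exists 0; rewrite ?leNye ?ltry.
    by exists (r - 1); rewrite ?leNye// lte_fin; lra.
  - by exists c.
have [V Vx aV] := lF x a aF.
have [y [Fy Vy]] := clx V Vx.
by have := lt_le_trans (aV y Vy) (le_trans Fy ca); rewrite ltxx.
Qed.

(** The sublevel sets at the values [F y], for [y] in [K], form a chain of closed sets that meet
    [K]; a common point in [K] is a minimizer. *)
Lemma lsc_compact_min (T : topologicalType) (R : realType) (F : T -> \bar R)
    (K : set T) :
  compact K -> K !=set0 -> lower_semicontinuous F ->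
  exists2 x, K x & forall y, K y -> (F x <= F y)%E.
Proof.
move=> cK K0 lF.
apply: (@compact_bigcap_directed _ _ K K (fun y => [set x | (F x <= F y)%E])) => //.
- by move=> y _; exact: lsc_closed_sublevel.
- by move=> y Ky; exists y; split=> /=.
- move=> x y Kx Ky; have [xy|/ltW yx] := leP (F x) (F y).
    by exists x => // z /= zx; split => //=; exact: le_trans xy.
  by exists y => // z /= zy; split => //=; exact: le_trans yx.
Qed.

Lemma lsc_comp_add (T X : topologicalType) (R : realType) (F : X -> \bar R)
    (h : T -> X) (g : T -> R) :
  lower_semicontinuous F -> continuous h -> continuous g ->
  lower_semicontinuous (fun t => F (h t) + (g t)%:E)%E.
Proof.
move=> lF ch cg t a aF.
(* The level [a] is split as [b + (a - b)], with [b] strictly below [F (h t)] and [a - b] strictly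
   below [g t]; both inequalities persist near [t]. *)
have [b ab bF] : exists2 b : R, a - g t < b & (b%:E < F (h t))%E.
  case: (F (h t)) aF => [r| |] //; last 1 first.
  - by exists (a - g t + 1); [lra|rewrite ltry].
  - rewrite -EFinD lte_fin => ar; exists ((a - g t + r) / 2); first by lra.
    by rewrite lte_fin; lra.
have [V Vt bV] := lF _ b bF.
have gt : \forall s \near t, a - b < g s.
  by apply: (cvgr_gt (g t) (cg t)); lra.
exists (h @^-1` V `&` [set s | a - b < g s]).
  by apply: filterI => //; exact: ch.
move=> s [Vs gs]; rewrite [X in (X%:E < _)%E](_ : a = b + (a - b)); last by lra.
by rewrite EFinD lteD// bV.
Qed.

Lemma continuous_subr (R : realType) (n : nat) (x : 'rV[R]_n) :
  continuous (fun y : 'rV[R]_n => y - x).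
Proof.
move=> y.
by have := cvgB (@cvg_id _ (nbhs y)) (@cvg_cst _ x _ (nbhs y) _); apply.
Qed.

Lemma compact_norm_ball (R : realType) (n : nat) (x : 'rV[R]_n) (r : R) :
  compact [set y | `|y - x| <= r].
Proof.
apply: bounded_closed_compact.
  exists (`|x| + r); split; first exact: num_real.
  move=> M M1 y /= yr; rewrite -(subrK x y).
  apply: le_trans (ler_normD _ _) _; lra.
apply: (@preimage_closed 'rV[R]_n R (fun y => `|y - x|) [set s | s <= r]).
  by move=> y _; apply: continuous_comp;
    [exact: continuous_subr|exact: norm_continuous].
exact: closed_le.
Qed.

(** * The Euclidean scalar product and regular normals *)

Section Dot.
Variables (R : realType) (n : nat).
Implicit Types x y z : 'rV[R]_n.

Lemma dotDl x y z : dot (x + y) z = dot x z + dot y z.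
Proof. by rewrite -big_split/=; apply: eq_bigr => i _; rewrite mxE mulrDl. Qed.

Lemma dotZl (a : R) x y : dot (a *: x) y = a * dot x y.
Proof. by rewrite mulr_sumr; apply: eq_bigr => i _; rewrite mxE mulrA. Qed.

Lemma dotC x y : dot x y = dot y x.
Proof. by apply: eq_bigr => i _; rewrite mulrC. Qed.

Lemma dotDr x y z : dot x (y + z) = dot x y + dot x z.
Proof. by rewrite dotC dotDl !(dotC _ x). Qed.

Lemma dotNl x y : dot (- x) y = - dot x y.
Proof. by rewrite -scaleN1r dotZl mulN1r. Qed.

Lemma dotNr x y : dot x (- y) = - dot x y.
Proof. by rewrite dotC dotNl dotC. Qed.

Lemma dot_sqrD x y : dot (x + y) (x + y) = dot x x + 2 * dot x y + dot y y.
Proof. by rewrite dotDl !dotDr (dotC y x); lra. Qed.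

Lemma dot_ge0 x : 0 <= dot x x.
Proof. by apply: sumr_ge0 => i _; rewrite -expr2 sqr_ge0. Qed.

Lemma sqr_enorm x : enorm x ^+ 2 = dot x x.
Proof. by rewrite sqr_sqrtr// dot_ge0. Qed.

Lemma norm_le_enorm x : `|x| <= enorm x.
Proof.
rewrite /enorm /Num.norm/= mx_normrE.
apply/bigmax_leP; split; first exact: sqrtr_ge0.
case=> i j _ /=; rewrite (ord1 i) -sqrtr_sqr ler_wsqrtr//.
rewrite /dot (bigD1 j)//= expr2 lerDl.
by apply: sumr_ge0 => k _; rewrite -expr2 sqr_ge0.
Qed.

Lemma dot_eq0 x : dot x x = 0 -> x = 0.
Proof.
move=> x0; apply/normr0_eq0/eqP; rewrite eq_le normr_ge0 andbT.
by have := norm_le_enorm x; rewrite /enorm x0 sqrtr0.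
Qed.

Lemma sqr_norm_le_dot x : `|x| ^+ 2 <= dot x x.
Proof. by rewrite -sqr_enorm lerXn2r ?nnegrE ?sqrtr_ge0 ?norm_le_enorm. Qed.

Lemma continuous_dot (T : topologicalType) (g h : T -> 'rV[R]_n) :
  continuous g -> continuous h -> continuous (fun t => dot (g t) (h t)).
Proof.
move=> cg ch; apply: continuous_big => [|i _ t]; first exact: add_continuous.
have coord : continuous (fun v : 'rV[R]_n => v 0 i) by exact: coord_continuous.
exact: cvgM (continuous_comp (cg t) (coord _)) (continuous_comp (ch t) (coord _)).
Qed.

Lemma continuous_enorm : continuous (@enorm R n).
Proof.
move=> x; apply: (@continuous_comp _ _ _ (fun x => dot x x) Num.sqrt).
  by apply: (@continuous_dot _ id id) => // y; exact: cvg_id.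
exact: sqrt_continuous.
Qed.

(** With [d = z' - z], the bound is at most [|c| |d|] times [|d|], and the first factor drops below
    any [eps] near [z]. *)
Lemma regular_normal_of_quadratic (C : set 'rV[R]_n) z xi (c : R) :
  (\forall z' \near z, C z' -> dot xi (z' - z) <= c * dot (z' - z) (z' - z)) ->
  regular_normal_cone C z xi.
Proof.
move=> quad eps eps0.
have small : \forall z' \near z, `|c| * enorm (z' - z) < eps.
  have lim : `|c| * enorm (z' - z) @[z' --> z] --> `|c| * enorm (z - z).
    exact: cvgMr (continuous_comp (@continuous_subr R n z z)
      (@continuous_enorm (z - z))).
  apply: (cvgr_lt _ lim); rewrite subrr /enorm /dot big1 ?sqrtr0 ?mulr0//.
  by move=> i _; rewrite !mxE mul0r.
apply: filterS2 quad small => z' quad small Cz'.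
apply: le_trans (quad Cz') _; rewrite -sqr_enorm.
apply: le_trans (_ : `|c| * enorm (z' - z) ^+ 2 <= _).
  by rewrite ler_wpM2r ?sqr_ge0 ?ler_norm.
by rewrite expr2 mulrA ler_wpM2r ?sqrtr_ge0// ltW.
Qed.

Lemma regular_normal_coneZ (C : set 'rV[R]_n) z xi (t : R) : 0 < t ->
  regular_normal_cone C z xi -> regular_normal_cone C z (t *: xi).
Proof.
move=> t0 nxi eps eps0; have nxit := nxi (eps / t) (divr_gt0 eps0 t0).
apply: filterS nxit => z' le; by rewrite dotZl -ler_pdivlMl// mulrA (mulrC t^-1).
Qed.

End Dot.

(** * The maximum norm and the product of R^n with R *)

Lemma norm_coord_le (R : realType) (n : nat) (x : 'rV[R]_n) i : `|x 0 i| <= `|x|.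
Proof.
rewrite [X in _ <= X]/Num.norm/= mx_normrE.
exact: (le_bigmax _ (fun ij : 'I_1 * 'I_n => `|x ij.1 ij.2|) (0, i)).
Qed.

Lemma norm_rV_le (R : realType) (n : nat) (x : 'rV[R]_n) (M : R) :
  0 <= M -> (forall i, `|x 0 i| <= M) -> `|x| <= M.
Proof.
move=> M0 xM; rewrite [X in X <= _]/Num.norm/= mx_normrE.
by apply/bigmax_leP; split => // -[i j] _; rewrite /= (ord1 i).
Qed.

Section Rpair.
Variables (R : realType) (n : nat).

Lemma rpairB (x y : 'rV[R]_n) (r s : R) :
  rpair x r - rpair y s = rpair (x - y) (r - s).
Proof.
rewrite /rpair opp_row_mx add_row_mx; congr row_mx.
by apply/rowP => i; rewrite !mxE.
Qed.

Lemma rpairZ (a : R) (x : 'rV[R]_n) (r : R) :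
  a *: rpair x r = rpair (a *: x) (a * r).
Proof.
rewrite /rpair scale_row_mx; congr row_mx.
by apply/rowP => i; rewrite !mxE.
Qed.

Lemma rpair_surj (z : 'rV[R]_(n + 1)) : exists x r, z = rpair x r.
Proof.
exists (lsubmx z), (rsubmx z 0 0); rewrite /rpair -[LHS]hsubmxK; congr row_mx.
by apply/rowP => i; rewrite (ord1 i) [RHS]mxE.
Qed.

Lemma dot_rpair (x y : 'rV[R]_n) (r s : R) :
  dot (rpair x r) (rpair y s) = dot x y + r * s.
Proof.
rewrite /dot big_split_ord/= big_ord1; congr (_ + _).
  by apply: eq_bigr => i _; rewrite !row_mxEl.
by rewrite !row_mxEr !mxE.
Qed.

Lemma norm_fst_le_rpair (x : 'rV[R]_n) (r : R) : `|x| <= `|rpair x r|.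
Proof.
apply: norm_rV_le => // i.
by have := norm_coord_le (rpair x r) (lshift 1 i); rewrite row_mxEl.
Qed.

End Rpair.

Lemma norm_snd_le_rpair (R : realType) (n : nat) (x : 'rV[R]_n) (r : R) :
  `|r| <= `|rpair x r|.
Proof.
by have := norm_coord_le (rpair x r) (rshift n 0); rewrite row_mxEr mxE.
Qed.

Lemma norm_rpair_le (R : realType) (n : nat) (x : 'rV[R]_n) (r M : R) :
  `|x| <= M -> `|r| <= M -> `|rpair x r| <= M.
Proof.
move=> xM rM; apply: norm_rV_le => [|i]; first exact: le_trans xM.
have [k ->|k ->] := split_ordP i.
  by rewrite row_mxEl; apply: le_trans (norm_coord_le _ _) xM.
by rewrite row_mxEr mxE.
Qed.

(** * Decoupled minimization and approximate stationarity *)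

Section FuzzySum.
Variables (R : realType) (n : nat) (f : 'rV[R]_n -> \bar R).
Variable Omega : set 'rV[R]_n.
Hypothesis f_gtNy : forall x, f x != -oo%E.
Hypothesis f_lsc : lower_semicontinuous f.
Hypothesis Omega_closed : closed Omega.

(** Expanding the square at [y' = y + d] turns minimality into
    [-2 c (y - z).d - (r' - r) <= c |d|^2], a quadratic bound for the normal inequality at
    [(y, r)]. *)
Lemma regular_normal_epi_of_min (y z : 'rV[R]_n) (r c : R) :
  f y = r%:E ->
  (\forall y' \near y,
     (r + c * dot (y - z) (y - z))%:E <=
     f y' + (c * dot (y' - z) (y' - z))%:E)%E ->
  regular_normal_cone (epi f) (rpair y r) (rpair ((- 2 * c) *: (y - z)) (- 1)).
Proof.
move=> fyr /nbhs_normP[e /= e0 ymin].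
apply: (@regular_normal_of_quadratic _ _ _ _ _ `|c|).
apply/nbhs_normP; exists e => //= _ /[swap] -[[y' r'] /= fr' <-].
rewrite /ball_/= => small; rewrite rpairB in small.
have {}ymin := ymin y' (le_lt_trans (norm_fst_le_rpair _ _) small).
rewrite rpairB !dot_rpair.
have {ymin} := le_trans ymin (leeD2r _ fr').
rewrite -EFinD lee_fin (_ : y' - z = (y - z) + (y' - y)); last first.
  by rewrite [RHS]addrC addrA subrK.
move: (y - z) (y' - y) => w d; rewrite dot_sqrD dotZl => ymin.
have cd : c * dot d d <= `|c| * dot d d by rewrite ler_wpM2r ?dot_ge0 ?ler_norm.
(* The squared distance in R^(n+1) also contains [(r' - r)^2], which only weakens the required
   bound. *)
have cr : 0 <= `|c| * ((r' - r) * (r' - r)) by rewrite mulr_ge0// -expr2 sqr_ge0.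
lra.
Qed.

(** Penalization: if every weight [c] left a minimizer on the boundary of a ball, such minimizers
    would persist in the limit of infinite [c], where [y = z] and [strict] leaves only the centre
    [xh]. The strict bounds on [y] and [z] make the minimum local, as is needed to obtain
    normals. *)
Lemma decoupled_minimum (h : 'rV[R]_n -> R) (xh : 'rV[R]_n) (a rho : R) :
  continuous h -> Omega xh -> f xh = a%:E -> 0 < rho ->
  (forall x, Omega x -> `|x - xh| <= rho ->
     (f x + (h x)%:E <= (a + h xh)%:E)%E -> x = xh) ->
  exists (c : R) y z, [/\ `|y - xh| < rho, `|z - xh| < rho, Omega z &
    forall y' z', `|y' - xh| <= rho -> `|z' - xh| <= rho -> Omega z' ->
      (f y + (c * dot (y - z) (y - z) + h z)%:E <=
       f y' + (c * dot (y' - z') (y' - z') + h z')%:E)%E].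
Proof.
move=> ch Oxh fxh rho0 strict.
pose B := [set y | `|y - xh| <= rho].
pose Phi (c : R) (p : 'rV[R]_n * 'rV[R]_n) :=
  (f p.1 + (c * dot (p.1 - p.2) (p.1 - p.2) + h p.2)%:E)%E.
pose K := B `*` (B `&` Omega).
have cK : compact K.
  apply: compact_setX; first exact: compact_norm_ball.
  by apply: compact_closedI => //; exact: compact_norm_ball.
have Phi_lsc c : lower_semicontinuous (Phi c).
  apply: lsc_comp_add => //; first by move=> p; exact: cvg_fst.
  have cd : continuous (fun p : 'rV[R]_n * 'rV[R]_n =>
      dot (p.1 - p.2) (p.1 - p.2)).
    by apply: continuous_dot; exact: sub_continuous.
  have ch2 : continuous (fun p : 'rV[R]_n * 'rV[R]_n => h p.2).
    move=> p.
    exact: continuous_comp (@cvg_snd _ _ (nbhs p.1) (nbhs p.2) _) (ch p.2).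
  by move=> p; exact: cvgD (cvgMr (cd p)) (ch2 p).
have Kxh : K (xh, xh) by split => //=; rewrite /B /= subrr normr0 ltW.
(* Within [K], the set [E] is where a ball constraint is active; a minimizer outside [E] would prove
   the claim. *)
pose E := [set p : 'rV[R]_n * 'rV[R]_n | rho <= `|p.1 - xh|]
  `|` [set p | rho <= `|p.2 - xh|].
have cE : closed E.
  have cn : closed [set y : 'rV[R]_n | rho <= `|y - xh|].
    apply: (@preimage_closed 'rV[R]_n R (fun y => `|y - xh|) [set s | rho <= s]).
    - by move=> y _; apply: continuous_comp;
        [exact: continuous_subr|exact: norm_continuous].
    - exact: closed_ge.
  apply: closedU.
    by apply: (@preimage_closed _ _ fst _ _ cn) => p _; exact: cvg_fst.
  by apply: (@preimage_closed _ _ snd _ _ cn) => p _; exact: cvg_snd.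
apply: contrapT => nomin.
(* The sets [S j] decrease, and a common point [(y, z)] in [K] has
   [j |y - z|^2] bounded in [j], so it is [(xh, xh)], which is not in [E]. *)
pose S (j : nat) := E `&` [set p | (Phi j%:R p <= (a + h xh)%:E)%E].
have [|j _|j _|i j _ _|[y z] [/= By [Bz Oz]] Syz] :=
    @compact_bigcap_directed _ _ K setT S cK.
- by exists 0%N.
- by apply: closedI => //; exact: lsc_closed_sublevel.
(* A minimizer of [Phi j] over [K] lies in [E] by [nomin], and comparison with [(xh, xh)], where the
   penalty vanishes, bounds its value. *)
- have [[y z] Kyz yzmin] := lsc_compact_min cK (ex_intro _ _ Kxh) (Phi_lsc j%:R).
  exists (y, z); split => //; split.
    apply: contrapT => /not_orP[/= /negP]; rewrite -ltNge => yr /negP.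
    rewrite -ltNge => zr; apply: nomin; exists j%:R, y, z; split => //.
      by case: Kyz => _ [].
    by move=> y' z' By' Bz' Oz'; exact: (yzmin (y', z')).
  have /= := yzmin _ Kxh; rewrite /Phi/= => /le_trans; apply.
  rewrite subrr /dot big1 ?fxh -?EFinD ?lee_fin ?mulr0 ?add0r// => k _.
  by rewrite !mxE mul0r.
- have mono k k' p : (k <= k')%N -> (Phi k%:R p <= Phi k'%:R p)%E.
    by move=> kk'; rewrite leeD2l// lee_fin lerD2r ler_wpM2r ?dot_ge0 ?ler_nat.
  exists (maxn i j) => // p [Ep Pp]; split; split => //=.
    by apply: le_trans Pp; exact/mono/leq_maxl.
  by apply: le_trans Pp; exact/mono/leq_maxr.
have [r fy] : exists r, f y = r%:E.
  have [_ /=] := Syz 0%N I; rewrite /Phi/=.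
  by have := f_gtNy y; case: (f y) => [r| |]// _ _; exists r.
have yz : y = z.
  apply/eqP; rewrite -subr_eq0; apply/eqP/dot_eq0/eqP.
  rewrite eq_le dot_ge0 andbT leNgt; apply/negP => d0.
  (* [b] is the largest weight for which the value at [(y, z)] stays below [a + h xh]; a natural
     number above it gives the contradiction. *)
  pose b := (a + h xh - r - h z) / dot (y - z) (y - z).
  have [_ /=] := Syz (Num.bound `|b|) I; rewrite /Phi/= fy -EFinD lee_fin.
  have bb : b < (Num.bound `|b|)%:R.
    exact: le_lt_trans (ler_norm _) (archi_boundP (normr_ge0 b)).
  by move: bb; rewrite /b ltr_pdivrMr//; lra.
subst y; have zxh : z = xh.
  apply: strict => //; have [_ /=] := Syz 0%N I.
  by rewrite /Phi/= mul0r add0r.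
by have [[]] := Syz 0%N I; rewrite /= zxh subrr normr0 leNgt rho0.
Qed.

Hypothesis inf_fin : ereal_inf (f @` Omega) \is a fin_num.
Hypothesis not_attained : ~ exists2 x, Omega x & f x = ereal_inf (f @` Omega).

(** On the compact part of [Omega] in the ball of radius [A], [f] has a minimum, which exceeds the
    infimum since the latter is not attained. Any [delta] smaller than this gap works. *)
Lemma near_minimizers_far (A : R) : exists2 delta : R, 0 < delta &
  forall x, Omega x -> (f x <= ereal_inf (f @` Omega) + delta%:E)%E -> A < `|x|.
Proof.
have [m fm] : exists m, ereal_inf (f @` Omega) = m%:E.
  by exists (fine (ereal_inf (f @` Omega))); rewrite fineK.
pose K := [set x | `|x - 0| <= A] `&` Omega.
have cK : compact K by apply: compact_closedI => //; exact: compact_norm_ball.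
have [[x0 Kx0]|K0] := pselect (K !=set0); last first.
  exists 1 => // x Ox _; rewrite ltNge; apply/negP => xA.
  by apply: K0; exists x; split => //=; rewrite subr0.
have [x1 [_ Ox1] x1min] := lsc_compact_min cK (ex_intro _ _ Kx0) f_lsc.
have mx1 : (m%:E < f x1)%E.
  rewrite lt_neqAle -fm; apply/andP; split.
    by apply/eqP => e; apply: not_attained; exists x1.
  by apply: ereal_inf_lbound; exists x1.
have [delta delta0 dx1] : exists2 delta, 0 < delta & ((m + delta)%:E < f x1)%E.
  case: (f x1) mx1 => [r| |] //; last by exists 1; rewrite ?ltry.
  rewrite lte_fin => mr; exists ((r - m) / 2); first by lra.
  by rewrite lte_fin; lra.
exists delta => // x Ox; rewrite fm -EFinD => xd.
rewrite ltNge; apply/negP => xA.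
have := x1min x; rewrite leNgt (le_lt_trans xd dx1) => /(_ _)/negP; apply => //.
by split => //=; rewrite subr0.
Qed.

(** This is a fuzzy sum rule for [f] plus the indicator of [Omega], at points beyond any radius [A]
    and with any error [e]. *)
Lemma approximate_stationarity (A e : R) : 0 < e ->
  exists y r z u v, [/\ f y = r%:E /\ Omega z, A <= `|y|, A <= `|z|,
    regular_normal_cone (epi f) (rpair y r) (rpair u (- 1)) &
    regular_normal_cone Omega z v /\ `|u + v| <= e].
Proof.
move=> e0; have [d0 d00 far] := near_minimizers_far (A + 1).
have [m fm] : exists m, ereal_inf (f @` Omega) = m%:E.
  by exists (fine (ereal_inf (f @` Omega))); rewrite fineK.
(* [delta <= d0] keeps [xh] far away, and [delta <= s^2] forces [|xh - x0| < s]. The final error is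
   at most [4 s + 2 s], hence the choice of [e / 8]; [s <= 1] is the margin in [A + 1]. *)
pose s := Num.min 1 (e / 8); pose delta := Num.min d0 (s ^+ 2).
have s0 : 0 < s by rewrite lt_min ltr01 divr_gt0.
have delta0 : 0 < delta by rewrite lt_min d00 exprn_gt0.
have [x0 Ox0 fx0] : exists2 x0, Omega x0 & (f x0 < (m + delta)%:E)%E.
  have [|_ [x0 Ox0 <-] fx0] := @ereal_inf_lt _ (f @` Omega) (m + delta)%:E.
    by rewrite fm lte_fin; lra.
  by exists x0.
have lb x : Omega x -> (m%:E <= f x)%E.
  by move=> Ox; rewrite -fm; apply: ereal_inf_lbound; exists x.
pose g (x : 'rV[R]_n) := dot (x - x0) (x - x0).
have cg (w : 'rV[R]_n) : continuous (fun x : 'rV[R]_n => dot (x - w) (x - w)).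
  by apply: continuous_dot; exact: continuous_subr.
pose K := [set x | `|x - x0| <= 1] `&` Omega.
have Kx0 : K x0 by split => //=; rewrite subrr normr0.
have cK : compact K by apply: compact_closedI => //; exact: compact_norm_ball.
have [xh [_ Oxh] xhmin] := lsc_compact_min cK (ex_intro _ _ Kx0)
  (lsc_comp_add f_lsc (fun x => @cvg_id _ (nbhs x)) (cg x0)).
have dot0 : dot (0 : 'rV[R]_n) 0 = 0 by apply: big1 => i _; rewrite !mxE mul0r.
have fg : (f xh + (g xh)%:E < (m + delta)%:E)%E.
  by apply: le_lt_trans (xhmin _ Kx0) _; rewrite subrr dot0 adde0.
have [a fa] : exists a, f xh = a%:E.
  have := f_gtNy xh; have := fg; case: (f xh) => [a| |] // _ _; by exists a.
have ma : m <= a by have := lb _ Oxh; rewrite fa lee_fin.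
have {}fg : a + g xh < m + delta by move: fg; rewrite fa.
have gxh : 0 <= g xh by exact: dot_ge0.
have near_x0 : `|xh - x0| < s.
  rewrite ltNge; apply/negP => sx.
  have : s ^+ 2 <= `|xh - x0| ^+ 2 by rewrite lerXn2r ?nnegrE// ltW.
  have := sqr_norm_le_dot (xh - x0); rewrite -/(g xh).
  have : delta <= s ^+ 2 by rewrite ge_min lexx orbT.
  lra.
have xhfar : A + 1 < `|xh|.
  apply: far => //; rewrite fa fm -EFinD lee_fin.
  have : delta <= d0 by rewrite ge_min lexx.
  lra.
have s1 : s <= 1 by rewrite ge_min lexx.
have se : s <= e / 8 by rewrite ge_min lexx orbT.
(* The ball of radius [rho] around [xh] stays in the unit ball around [x0], on which [xh] is
   minimal. *)
pose rho := Num.min (1 - `|xh - x0|) s.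
have rho0 : 0 < rho by rewrite lt_min s0 andbT; lra.
have rhos : rho <= s by rewrite ge_min lexx orbT.
have rhox : rho <= 1 - `|xh - x0| by rewrite ge_min lexx.
(* The second square makes [xh] the only minimizer of [f + h] on the points of [Omega] in the small
   ball, as [decoupled_minimum] demands. *)
pose h (x : 'rV[R]_n) := g x + dot (x - xh) (x - xh).
have ch : continuous h by move=> x; exact: cvgD (cg x0 x) (cg xh x).
have [|c [y [z [yrho zrho Oz yzmin]]]] :=
    decoupled_minimum ch Oxh fa rho0.
  move=> x Ox xrho.
  have Kx : K x.
    split => //=; rewrite -[x - x0](subrKA xh).
    by apply: le_trans (ler_normD _ _) _; lra.
  have := xhmin x Kx; rewrite fa -/(g x) -/(g xh).
  have := f_gtNy x; case: (f x) => [b| |] // _.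
  rewrite -!EFinD !lee_fin /h subrr dot0 => min1 min2.
  apply/eqP; rewrite -subr_eq0; apply/eqP/dot_eq0/eqP.
  rewrite eq_le dot_ge0 andbT; lra.
have [r fy] : exists r, f y = r%:E.
  have := yzmin xh xh; rewrite subrr normr0 fa -EFinD => /(_ (ltW rho0) (ltW rho0) Oxh).
  by have := f_gtNy y; case: (f y) => [r| |]// _ _; exists r.
have xh_far_near x : `|x - xh| < rho -> A <= `|x|.
  move=> xr; have : `|xh| <= `|xh - x| + `|x|.
    by have := ler_normD (xh - x) x; rewrite subrK.
  rewrite distrC; lra.
have near_ball x : `|x - xh| < rho -> \forall x' \near x, `|x' - xh| <= rho.
  move=> xr; have lim : `|x' - xh| @[x' --> x] --> `|x - xh|.
    exact: continuous_comp (@continuous_subr R n xh x)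
      (@norm_continuous _ _ (x - xh)).
  exact: (cvgr_le _ lim).
(* The two vectors are minus the gradients of the smooth part [c |y - z|^2 + h z] in [y] and in [z];
   the coupling terms cancel in their sum. *)
exists y, r, z, ((- 2 * c) *: (y - z)),
  ((2 * c) *: (y - z) - 2 *: (z - x0) - 2 *: (z - xh)).
split; [by split|exact: xh_far_near|exact: xh_far_near| |split].
- apply: regular_normal_epi_of_min => //.
  apply: filterS (near_ball y yrho) => y' y'rho.
  have := yzmin y' z y'rho (ltW zrho) Oz.
  have := f_gtNy y'; rewrite fy; case: (f y') => [b| |]// _.
    by rewrite -!EFinD !lee_fin; lra.
  by rewrite !addye ?leey.
(* The second-order coefficient is [c] from the coupling and 1 from each of the two squares in
   [h]. *)
- apply: (@regular_normal_of_quadratic _ _ _ _ _ (c + 2)).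
  apply: filterS (near_ball z zrho) => z' z'rho Oz'.
  have := yzmin y z' (ltW yrho) z'rho Oz'.
  rewrite fy -!EFinD lee_fin /h /g.
  rewrite (_ : y - z' = (y - z) + - (z' - z)); last by rewrite opprB addrA subrK.
  rewrite (_ : z' - x0 = (z - x0) + (z' - z)); last by rewrite [RHS]addrC addrA subrK.
  rewrite (_ : z' - xh = (z - xh) + (z' - z)); last by rewrite [RHS]addrC addrA subrK.
  move: (y - z) (z - x0) (z - xh) (z' - z) => w w0 wh d.
  by rewrite !dot_sqrD !dotDl !dotNl !dotNr !dotZl; lra.
- rewrite (_ : _ + _ = - (4 *: (z - xh) + 2 *: (xh - x0))); last first.
    by apply/rowP => i; rewrite !mxE; lra.
  rewrite normrN; apply: le_trans (ler_normD _ _) _.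
  rewrite !normrZ !ger0_norm//; lra.
Qed.

End FuzzySum.

(** * Limits and scaling of normals at infinity *)

Lemma cvg_harmonic_bound (R : realType) (V : normedModType R) (x_ : nat -> V)
    (x : V) (c : R) :
  (forall k, `|x - x_ k| <= c * harmonic k) -> x_ k @[k --> \oo] --> x.
Proof.
move=> xc; apply/cvgrPdist_lt => e e0.
have lim : c * harmonic k @[k --> \oo] --> c * 0 by exact: cvgMr cvg_harmonic.
rewrite mulr0 in lim.
have small : \forall k \near \oo, c * harmonic k < e by apply: (cvgr_lt _ lim).
by apply: filterS small => k; exact: le_lt_trans.
Qed.

Section ConeAtInfinity.
Variables (R : realType) (n : nat).

Lemma cvg_enorm_pinfty (x_ : nat -> 'rV[R]_n) :
  (forall k, k%:R <= `|x_ k|) -> enorm (x_ k) @[k --> \oo] --> +oo.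
Proof.
move=> xk; apply/cvgryPge => A.
have /cvgryPge/(_ A) := @cvgr_idn R.
apply: filterS => k Ak.
exact: le_trans Ak (le_trans (xk k) (norm_le_enorm _)).
Qed.

Lemma normal_cone_inftyZ (Omega : set 'rV[R]_n) (v : 'rV[R]_n) (t : R) :
  0 < t -> normal_cone_infty Omega v -> normal_cone_infty Omega (t *: v).
Proof.
move=> t0 [x_ [v_ [Ox xoo nv vv]]]; exists x_, (fun k => t *: v_ k); split => //.
  by move=> k; exact: regular_normal_coneZ.
by apply: cvgZr.
Qed.

Lemma epi_normal_cone_inftyZ (f : 'rV[R]_n -> \bar R) zeta (t : R) :
  0 < t -> epi_normal_cone_infty f zeta -> epi_normal_cone_infty f (t *: zeta).
Proof.
move=> t0 [x_ [r_ [z_ [fx xoo nz zz]]]].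
exists x_, r_, (fun k => t *: z_ k); split => //.
  by move=> k; exact: regular_normal_coneZ.
by apply: cvgZr.
Qed.

End ConeAtInfinity.

(** * Passage to the limit at infinity *)

Theorem theorem6p1 (R : realType) (n : nat) (f : 'rV[R]_n -> \bar R)
    (Omega : set 'rV[R]_n)
    (f_gtNy : forall x, f x != -oo%E)
    (f_lsc : lower_semicontinuous f)
    (Omega_closed : closed Omega)
    (A1 : ~ [bounded enorm x | x in edom f `&` Omega])
    (A2 : singular_subdiff_infty f `&`
            [set - v | v in normal_cone_infty Omega] = [set 0])
    (A3 : ereal_inf (f @` Omega) \is a fin_num)
    (not_attained : ~ exists2 x, Omega x & f x = ereal_inf (f @` Omega)) :
  [set u + v | u in subdiff_infty f & v in normal_cone_infty Omega] 0.
Proof.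
have /choice[y_ /choice[r_ /choice[z_ /choice[u_ /choice[v_ H]]]]] (k : nat) :=
  approximate_stationarity f_gtNy f_lsc Omega_closed A3 not_attained k%:R
    (@harmonic_gt0 R k).
(* This scaling gives the identity [tu], which bounds the normals [zeta k] and, surviving in the
   limit as [ws], keeps the limit away from 0. *)
pose t k := (1 + `|u_ k|)^-1.
have u0 k : 0 < 1 + `|u_ k| by rewrite ltr_pwDl.
have t0 k : 0 < t k by rewrite invr_gt0.
have tu k : t k + `|t k *: u_ k| = 1.
  by rewrite normrZ gtr0_norm// -{1}[t k]mulr1 -mulrDr mulVf// gt_eqF.
have t1 k : t k <= 1 by rewrite -(tu k) lerDl.
pose zeta k := rpair (t k *: u_ k) (- t k).
have [zl [_ cl]] : [set x : 'rV[R]_(n + 1) | `|x - 0| <= 1]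
    `&` cluster (zeta k @[k --> \oo]) !=set0.
  apply: compact_norm_ball; exists 0%N => // k _ /=; rewrite subr0.
  by apply: norm_rpair_le; rewrite ?normrN ?(gtr0_norm (t0 k))// -(tu k) lerDr ltW.
have [w [s zlE]] := rpair_surj zl.
have /choice[phi Hphi] (k : nat) : exists i, (k <= i)%N /\ `|zl - zeta i| < harmonic k.
  have zlk : \forall x \near zl, `|zl - x| < harmonic k.
    by apply/nbhs_normP; exists (harmonic k) => //=; exact: harmonic_gt0.
  have [||x [[i ki <-] xk]] := cl [set zeta i | i in [set i | (k <= i)%N]]
      [set x | `|zl - x| < harmonic k].
  - by exists k => // i ki; exists i.
  - exact: zlk.
  by exists i.
(* [phi] need not be increasing: [k <= phi k] already sends the base points to infinity and the
   errors to 0. *)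
have kphi k : (k <= phi k)%N := (Hphi k).1.
have kphiR k : k%:R <= (phi k)%:R :> R by rewrite ler_nat.
have harm k : harmonic (phi k) <= harmonic k :> R.
  by rewrite /harmonic/= lef_pV2 ?posrE ?ltr0n// ler_nat ltnS.
have close k : `|rpair (w - t (phi k) *: u_ (phi k)) (s + t (phi k))| <= harmonic k.
  by have := ltW (Hphi k).2; rewrite zlE /zeta rpairB opprK.
have close_u k := le_trans (norm_fst_le_rpair _ _) (close k).
have close_t k := le_trans (norm_snd_le_rpair _ _) (close k).
have ws : `|w| - s = 1.
  have lim : (fun=> 1 : R) @ \oo --> `|w| - s.
    apply: (@cvg_harmonic_bound _ _ _ _ 2) => k.
    have -> : `|w| - s - 1 =
        (`|w| - `|t (phi k) *: u_ (phi k)|) - (s + t (phi k)).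
      by have := tu (phi k); lra.
    apply: le_trans (ler_normB _ _) _; rewrite mulr_natl mulr2n.
    by apply: lerD (close_t k); exact: le_trans (ler_dist_dist _ _) (close_u k).
  rewrite -(cvg_lim (@Rhausdorff R) lim); apply: (cvg_lim (@Rhausdorff R)).
  exact: cvg_cst.
have s_le0 : s <= 0.
  have lim : - t (phi k) @[k --> \oo] --> s.
    by apply: (@cvg_harmonic_bound _ _ _ _ 1) => k; rewrite opprK mul1r.
  have t_le0 : \forall k \near \oo, - t (phi k) <= 0.
    by apply: nearW => k; rewrite oppr_le0 ltW.
  rewrite -(cvg_lim (@Rhausdorff R) lim); apply: limr_le t_le0.
  by apply/cvg_ex; exists s.
have Nepi : epi_normal_cone_infty f (rpair w s).
  exists (y_ \o phi), (r_ \o phi), (zeta \o phi); split => /=.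
  - move=> k; have [[fy _] _ _ _ _] := H (phi k).
    by exists (y_ (phi k), r_ (phi k)) => //=; rewrite fy.
  - apply: cvg_enorm_pinfty => k; have [_ yk _ _ _] := H (phi k).
    exact: le_trans (kphiR k) yk.
  - move=> k; have [_ _ _ nk _] := H (phi k).
    by have := regular_normal_coneZ (t0 (phi k)) nk; rewrite rpairZ mulrN1.
  - apply: (@cvg_harmonic_bound _ _ _ _ 1) => k.
    by rewrite mul1r rpairB opprK.
have NOmega : normal_cone_infty Omega (- w).
  exists (z_ \o phi), (fun k => t (phi k) *: v_ (phi k)); split => /=.
  - by move=> k; have [[_ Oz] _ _ _ _] := H (phi k).
  - apply: cvg_enorm_pinfty => k; have [_ _ zk _ _] := H (phi k).
    exact: le_trans (kphiR k) zk.
  - move=> k; have [_ _ _ _ [nk _]] := H (phi k).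
    exact: regular_normal_coneZ.
  (* One [harmonic k] comes from [close_u], the other from [|u + v| <= harmonic (phi k)] together
     with [t <= 1]. *)
  - apply: (@cvg_harmonic_bound _ _ _ _ 2) => k.
    have [_ _ _ _ [_ uvk]] := H (phi k).
    rewrite -normrN (_ : - (- w - t (phi k) *: v_ (phi k)) =
      (w - t (phi k) *: u_ (phi k)) + t (phi k) *: (u_ (phi k) + v_ (phi k))); last first.
      by apply/rowP => i; rewrite !mxE; lra.
    apply: le_trans (ler_normD _ _) _; rewrite normrZ gtr0_norm//.
    have : t (phi k) * `|u_ (phi k) + v_ (phi k)| <= `|u_ (phi k) + v_ (phi k)|.
      by rewrite ler_piMl.
    have := close_u k; have := harm k; lra.
have s_lt0 : s < 0.
  rewrite lt_neqAle s_le0 andbT; apply/eqP => s0.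
  (* If [s = 0], then [w] lies in both sets of [A2] and so vanishes, against [|w| - s = 1]. *)
  have : [set 0] w.
    rewrite -A2; split; first by rewrite /singular_subdiff_infty /= -s0.
    by exists (- w) => //; rewrite opprK.
  by move=> /= w0; move: ws; rewrite w0 s0 normr0; lra.
have c0 : 0 < (- s)^-1 by rewrite invr_gt0 oppr_gt0.
exists ((- s)^-1 *: w).
  have := epi_normal_cone_inftyZ c0 Nepi; rewrite rpairZ.
  by rewrite (_ : (- s)^-1 * s = - 1)//; field; rewrite lt_eqF.
exists ((- s)^-1 *: - w); first exact: normal_cone_inftyZ.
by rewrite scalerN subrr.
Qed.
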